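(* Let $E$ and $F$ be Banach lattices and let $T:E\to F$ be a linear disjointness preserving operator. Let $E_T$ be the ideal of $E$ described in the context. Then there exists an order dense norm closed ideal $I_T$ in $E$, with $E_T\subseteq I_T$, such that the restriction $T|_{I_T}$ can be written as $T|_{I_T}=R+S$, where $R:I_T\to F$ is a norm bounded disjointness preserving linear operator with $R=T$ on $E_T$, and $S:I_T\to F$ is a disjointness preserving linear operator with $S=0$ on $E_T$. Moreover, $R$ and $S$ are uniquely determined by these properties.
   Context: Elements $x,y$ of a Banach lattice are disjoint, $x\perp y$, if $|x|\wedge|y|=0$. A linear operator (not assumed continuous) between Riesz spaces is disjointness preserving if it maps disjoint elements to disjoint elements. An ideal of $E$ is a (not necessarily closed) linear subspace $I$ such that $|y|\le|x|$, $x\in I$ implies $y\in I$; it is order dense if $I^d=\{y\in E:y\perp x\text{ for all }x\in I\}=\{0\}$. For $0\le u\in E$, $A_u=\{y\in E:|y|\le\lambda u\text{ for some }\lambda\ge0\}$ is the principal ideal generated by $u$. Definition of $E_T$: fix a maximal set $\mathcal{U}$ of pairwise disjoint elements $0<u\in E$ such that the restriction $T|_{A_u}$ is bounded with respect to the norm of $E$ on $A_u$; $E_T$ is the ideal of $E$ generated by $\mathcal{U}$. (It is an order dense ideal on which $T$ is norm bounded.) *)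

(* Defs.v *)
From HB Require Import structures.
From mathcomp Require Import all_boot all_order all_algebra.
From mathcomp Require Import boolp classical_sets reals topology normedtype.

Set Implicit Arguments.
Unset Strict Implicit.
Unset Printing Implicit Defensive.

Import Order.TTheory GRing.Theory Num.Theory.

Local Open Scope classical_set_scope.
Local Open Scope ring_scope.

Reserved Notation "x <=v y" (at level 70, y at next level).
Reserved Notation "x <v y" (at level 70, y at next level).

(* The lattice order is not an instance of [Order.Lattice]: HB requires joins to
   be declared bottom-up, and the library joins orders with additions and norms
   only in its numeric structures. *)
HB.mixin Record Lmodule_isRiesz (R : realType) E of GRing.Lmodule R E := {
  vle : rel E ;
  vmeet : E -> E -> E ;
  vjoin : E -> E -> E ;
  vle_refl : reflexive vle ;
  vle_anti : antisymmetric vle ;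
  vle_trans : transitive vle ;
  vle_meet : forall x y z, vle z (vmeet x y) = vle z x && vle z y ;
  vle_join : forall x y z, vle (vjoin x y) z = vle x z && vle y z ;
  vle_add2r : forall z x y, vle x y -> vle (x + z) (y + z) ;
  vle_scale : forall (a : R) x, 0 <= a -> vle 0 x -> vle 0 (a *: x)
}.

#[short(type="rieszType")]
HB.structure Definition Riesz (R : realType) :=
  {E of GRing.Lmodule R E & Lmodule_isRiesz R E}.

Notation "x <=v y" := (vle x y) : ring_scope.
Notation "x <v y" := (vle x y /\ x <> y) : ring_scope.

(* |x| of the lattice; the backquoted bars `|x| denote the norm *)
Definition modulus (R : realType) (E : rieszType R) (x : E) : E :=
  vjoin x (- x).

HB.mixin Record Riesz_isBanachLattice (R : realType) E
    of Riesz R E & CompleteNormedModule R E := {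
  ler_norm_modulus : forall x y : E,
    modulus x <=v modulus y -> `|x| <= `|y| :> R
}.

#[short(type="banachLatticeType")]
HB.structure Definition BanachLattice (R : realType) :=
  {E of Riesz R E & CompleteNormedModule R E & Riesz_isBanachLattice R E}.

Section RieszSpace.
Variables (R : realType) (E : rieszType R).

Definition disjoint (x y : E) := vmeet (modulus x) (modulus y) = 0.

Definition disjoint_complement (A : set E) : set E :=
  [set y | forall x, A x -> disjoint y x].

Definition is_ideal (I : set E) :=
  [/\ I 0,
      forall (a : R) x y, I x -> I y -> I (a *: x + y) &
      forall x y, I x -> modulus y <=v modulus x -> I y].

Definition order_dense (I : set E) := disjoint_complement I = [set 0].

Definition ideal_generated (A : set E) : set E := smallest is_ideal A.

Definition principal_ideal (u : E) : set E :=
  [set y | exists2 a : R, 0 <= a & modulus y <=v a *: u].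

End RieszSpace.

(* Operators defined on an ideal [A] are encoded as total functions of which
   only the values on [A] matter. *)
Section OperatorsOnSets.
Variables (R : realType) (E F : banachLatticeType R).
Implicit Types (A : set E) (f : E -> F).

Definition linear_on A f :=
  forall (a : R) x y, A x -> A y -> f (a *: x + y) = a *: f x + f y.

Definition disjointness_preserving_on A f :=
  forall x y, A x -> A y -> disjoint x y -> disjoint (f x) (f y).

Definition norm_bounded_on A f :=
  exists C : R, forall x, A x -> `|f x| <= C * `|x|.

(* E_T is the ideal generated by a maximal bounding family of T. *)
Definition bounding_family f (U : set E) :=
  (forall u, U u -> 0 <v u /\ norm_bounded_on (principal_ideal u) f) /\
  (forall u v, U u -> U v -> u <> v -> disjoint u v).

Definition maximal_bounding_family f (U : set E) :=
  bounding_family f U /\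
  forall V, bounding_family f V -> U `<=` V -> V = U.

Definition bounded_plus_singular f (E_T I : set E) (Rf Sf : E -> F) :=
  [/\ forall x, I x -> f x = Rf x + Sf x,
      [/\ linear_on I Rf, disjointness_preserving_on I Rf,
          norm_bounded_on I Rf & forall x, E_T x -> Rf x = f x] &
      [/\ linear_on I Sf, disjointness_preserving_on I Sf &
          forall x, E_T x -> Sf x = 0]].

End OperatorsOnSets.

(* Main.v *)
(* The gliding hump argument drives everything: if pairwise disjoint [x n] had
   summable norms and [|T (x n)| >= n], their sum [s] would satisfy
   [|T (x n)| <= |T s|] for all [n], because [x n] and [s - x n] are disjoint.
   It yields, inside every nonzero principal ideal, a nonzero principal ideal on
   which [T] is bounded, so [E_T] is order dense by maximality of [U]; applied to
   humps supported on disjoint finite subsets of [U], it shows that [T] is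
   bounded on [E_T].  Take [I_T] to be the closure of [E_T], [R_T] the bounded
   extension of [T] and [S_T = T - R_T].  Elements of [I_T] are limits of elements
   of [E_T] of smaller modulus, so [T x], [R_T x] are disjoint from [T y], [R_T y]
   whenever [x] and [y] are disjoint. *)
Require Import Defs.
From mathcomp Require Import all_boot all_order all_algebra.
From mathcomp Require Import boolp classical_sets reals topology normedtype.
From mathcomp Require Import sequences lra.

Set Implicit Arguments.
Unset Strict Implicit.
Unset Printing Implicit Defensive.

(* [Defs] again, to undo the shadowing of [disjoint] by [fintype] *)
Import Defs Order.TTheory GRing.Theory Num.Theory.

Local Open Scope classical_set_scope.
Local Open Scope ring_scope.

(** * Order, modulus and disjointness in Riesz spaces *)

Section RieszTheory.
Variables (R : realType) (E : rieszType R).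
Implicit Types (x y z u v p q r : E) (a b c : R).

Lemma vle_tr x y z : x <=v y -> y <=v z -> x <=v z.
Proof. exact: vle_trans. Qed.

Lemma vleD p q x y : p <=v q -> x <=v y -> p + x <=v q + y.
Proof.
move=> pq xy; apply: (@vle_tr _ (q + x)); first exact: vle_add2r.
by rewrite ![q + _]addrC vle_add2r.
Qed.

Lemma vlerBlDr x y z : (x - y <=v z) = (x <=v z + y).
Proof.
apply/idP/idP => /vle_add2r; first by move=> /(_ y); rewrite subrK.
by move=> /(_ (- y)); rewrite addrK.
Qed.

Lemma vlerBrDr x y z : (x <=v y - z) = (x + z <=v y).
Proof. by rewrite -vlerBlDr opprK. Qed.

Lemma vleN x y : (- x <=v - y) = (y <=v x).
Proof. by rewrite -[- x]add0r vlerBlDr addrC vlerBrDr add0r. Qed.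

Lemma vlezD x p q : x <=v p -> 0 <=v q -> x <=v p + q.
Proof. by move=> xp q0; rewrite -[x]addr0 vleD. Qed.

Lemma vleZ a x y : 0 <= a -> x <=v y -> a *: x <=v a *: y.
Proof.
move=> a0 xy; have := @vle_scale _ _ a (y - x) a0.
by rewrite vlerBrDr add0r scalerBr vlerBrDr add0r; apply.
Qed.

Lemma vleZr a b x : a <= b -> 0 <=v x -> a *: x <=v b *: x.
Proof.
move=> ab x0; have := @vle_scale _ _ (b - a) x.
by rewrite subr_ge0 scalerBl vlerBrDr add0r; apply.
Qed.

Lemma vle_joinl x y : x <=v vjoin x y.
Proof. by have := vle_refl (vjoin x y); rewrite vle_join => /andP[]. Qed.

Lemma vle_joinr x y : y <=v vjoin x y.
Proof. by have := vle_refl (vjoin x y); rewrite vle_join => /andP[]. Qed.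

Lemma vle_meetl x y : vmeet x y <=v x.
Proof. by have := vle_refl (vmeet x y); rewrite vle_meet => /andP[]. Qed.

Lemma vle_meetr x y : vmeet x y <=v y.
Proof. by have := vle_refl (vmeet x y); rewrite vle_meet => /andP[]. Qed.

Lemma modulus_le x y : (modulus x <=v y) = (x <=v y) && (- y <=v x).
Proof. by rewrite vle_join -[- x <=v y]vleN opprK. Qed.

Lemma le_modulus x : x <=v modulus x.
Proof. exact: vle_joinl. Qed.

Lemma leN_modulus x : - modulus x <=v x.
Proof. by rewrite -vleN opprK vle_joinr. Qed.

Lemma modulus_ge0 x : 0 <=v modulus x.
Proof.
have := vleD (vle_joinl x (- x)) (vle_joinr x (- x)).
rewrite subrr -/(modulus x) -mulr2n -scaler_nat => /(@vleZ 2^-1).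
rewrite scaler0 scalerA mulVf ?pnatr_eq0// scale1r; apply.
by rewrite invr_ge0 ler0n.
Qed.

Lemma modulus_id x : 0 <=v x -> modulus x = x.
Proof.
move=> x0; apply: vle_anti; rewrite le_modulus modulus_le vle_refl/= andbT.
by apply: (@vle_tr _ 0) => //; rewrite -oppr0 vleN.
Qed.

Lemma modulus_modulus x : modulus (modulus x) = modulus x.
Proof. exact/modulus_id/modulus_ge0. Qed.

Lemma modulus0 : modulus 0 = 0 :> E.
Proof. exact/modulus_id/vle_refl. Qed.

Lemma modulusN x : modulus (- x) = modulus x.
Proof.
rewrite /modulus opprK; apply: vle_anti.
by rewrite !vle_join !vle_joinl !vle_joinr.
Qed.

Lemma modulusD x y : modulus (x + y) <=v modulus x + modulus y.
Proof.
by rewrite modulus_le opprD !vleD// ?le_modulus ?leN_modulus.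
Qed.

Lemma modulusZ_le a x : modulus (a *: x) <=v `|a| *: modulus x.
Proof.
have [a0|a0] := ger0P a.
  by rewrite modulus_le -scalerN !vleZ ?le_modulus ?leN_modulus.
rewrite -modulusN -scaleNr modulus_le -scalerN.
by rewrite !vleZ ?le_modulus ?leN_modulus// oppr_ge0 ltW.
Qed.

Lemma modulus_eq0 x : modulus x = 0 -> x = 0.
Proof.
move=> x0; apply: vle_anti; have := le_modulus x; have := leN_modulus x.
by rewrite x0 oppr0 => -> ->.
Qed.

(** [x1] truncates [x] to the order interval from [- p] to [p]. The bound of [x1] by [modulus x]
    later keeps approximants below the vector they approximate. *)
Lemma riesz_decomposition x p q : 0 <=v p -> 0 <=v q -> modulus x <=v p + q ->
  exists x1 x2, [/\ x = x1 + x2, modulus x1 <=v p, modulus x2 <=v q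
                  & modulus x1 <=v modulus x].
Proof.
move=> p0 q0; rewrite modulus_le => /andP[xpq pqx].
have Np0 : - p <=v 0 by rewrite -oppr0 vleN.
pose x1 := vjoin (vmeet x p) (- p).
exists x1, (x - x1); rewrite addrC subrK; split=> //.
- rewrite modulus_le vle_joinr vle_join vle_meetr/= andbT.
  exact: vle_tr p0.
- rewrite modulus_le; apply/andP; split.
    rewrite vlerBlDr [q + _]addrC -vlerBlDr.
    apply: vle_tr (vle_joinl _ _).
    by rewrite vle_meet !vlerBlDr xpq andbT vlezD ?vle_refl.
  rewrite vlerBrDr [- q + _]addrC vlerBlDr vle_join vlezD ?vle_meetl//=.
  by rewrite -vlerBlDr -opprD.
- rewrite modulus_le vle_join (vle_tr (vle_meetl _ _)) ?le_modulus//=.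
  rewrite (vle_tr Np0) ?modulus_ge0//=.
  apply: vle_tr (vle_joinl _ _); rewrite vle_meet leN_modulus/=.
  by apply: vle_tr p0; rewrite -oppr0 vleN modulus_ge0.
Qed.

Lemma disjointC x y : disjoint x y -> disjoint y x.
Proof.
rewrite /disjoint => <-; apply: vle_anti.
by rewrite !vle_meet !vle_meetl !vle_meetr.
Qed.

Lemma disjointP x y : disjoint x y <->
  forall z, z <=v modulus x -> z <=v modulus y -> z <=v 0.
Proof.
split=> [<- z zx zy|xy]; first by rewrite vle_meet zx.
apply: vle_anti; rewrite vle_meet !modulus_ge0 /= andbT.
by apply: xy; rewrite ?vle_meetl ?vle_meetr.
Qed.

Lemma disjoint_le x y x' y' : modulus x' <=v modulus x ->
  modulus y' <=v modulus y -> disjoint x y -> disjoint x' y'.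
Proof.
move=> xx yy /disjointP xy; apply/disjointP => z zx zy.
by apply: xy; [apply: vle_tr xx|apply: vle_tr yy].
Qed.

Lemma disjoint_lel x y x' : modulus x' <=v modulus x ->
  disjoint x y -> disjoint x' y.
Proof. by move=> xx; apply: disjoint_le => //; exact: vle_refl. Qed.

Lemma disjoint0l x : disjoint 0 x.
Proof. by apply/disjointP => z; rewrite modulus0. Qed.

(* The common estimate behind additivity and norm closedness of [x^d]. *)
Lemma disjoint_meet_le x y q z : disjoint x y -> 0 <=v q ->
  z <=v modulus x + q -> z <=v modulus y -> z <=v q.
Proof.
move=> /disjointP xy q0 zxq zy; rewrite -[q]add0r -vlerBlDr; apply: xy.
  by rewrite vlerBlDr.
by rewrite vlerBlDr vlezD.
Qed.

Lemma disjointDl x y z : disjoint x z -> disjoint y z -> disjoint (x + y) z.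
Proof.
move=> xz /disjointP yz; apply/disjointP => w wxy wz; apply: yz => //.
apply: disjoint_meet_le xz _ _ wz; first exact: modulus_ge0.
exact: vle_tr (modulusD _ _).
Qed.

(** The positive part of a common lower bound is divided by [|a| + 1]: this is invertible even for
    [a = 0], and at least 1, so the quotient stays below [modulus z]. *)
Lemma disjointZl a x z : disjoint x z -> disjoint (a *: x) z.
Proof.
move=> /disjointP xz; apply/disjointP => w wx wz.
have c1 : 1 <= `|a| + 1 by rewrite lerDr.
have c0 : 0 < `|a| + 1 by rewrite (lt_le_trans ltr01).
have cV : 0 <= (`|a| + 1)^-1 by rewrite invr_ge0 ltW.
pose m := vjoin w 0.
have m0 : 0 <=v m by exact: vle_joinr.
have mz : m <=v modulus z by rewrite vle_join wz modulus_ge0.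
have mx : m <=v (`|a| + 1) *: modulus x.
  rewrite vle_join vle_scale ?modulus_ge0 ?(ltW c0)// andbT.
  apply: vle_tr wx _; apply: vle_tr (modulusZ_le _ _) _.
  by rewrite vleZr ?modulus_ge0// lerDl.
have : (`|a| + 1)^-1 *: m <=v 0.
  apply: xz.
    rewrite -[modulus x](scalerK (lt0r_neq0 c0)).
    exact: vleZ.
  apply: vle_tr mz; rewrite -{2}[m]scale1r vleZr//.
  by rewrite invf_le1.
move=> /(vleZ (ltW c0)); rewrite scalerA divff ?lt0r_neq0// scale1r scaler0.
exact: vle_tr (vle_joinl _ _).
Qed.

Lemma disjointNl x z : disjoint x z -> disjoint (- x) z.
Proof. by move=> xz; rewrite -scaleN1r; exact: disjointZl. Qed.

Lemma disjointBl x y z : disjoint x z -> disjoint y z -> disjoint (x - y) z.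
Proof. by move=> xz yz; apply: disjointDl => //; exact: disjointNl. Qed.

(** In [modulus x <= modulus y + modulus (x + y)], [disjoint_meet_le] drops the term [modulus y]. *)
Lemma disjoint_le_add x y : disjoint x y -> modulus x <=v modulus (x + y).
Proof.
move=> /disjointC xy; apply: disjoint_meet_le xy _ _ (vle_refl _).
  exact: modulus_ge0.
by rewrite -{1}[x](addrK y) addrC; rewrite -(modulusN y); exact: modulusD.
Qed.

Lemma disjoint_self x : disjoint x x -> x = 0.
Proof.
move=> /disjointP xx; apply: modulus_eq0; apply: vle_anti.
by rewrite modulus_ge0 xx ?vle_refl.
Qed.

(** If [z] is below both parts, then [x+ - z] is above [0] and, as [x- = x+ - x], above [x]; so it
    is above [x+]. *)
Lemma disjoint_pos_neg x : disjoint (vjoin x 0) (vjoin (- x) 0).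
Proof.
apply/disjointP => z; rewrite !modulus_id ?vle_joinr// => zp zn.
suff : vjoin x 0 <=v vjoin x 0 - z.
  by rewrite vlerBrDr addrC -vlerBrDr subrr.
rewrite vle_join !vlerBrDr add0r zp andbT addrC -vlerBrDr.
apply: vle_tr zn _; rewrite vle_join !vlerBrDr addNr add0r.
by rewrite vle_joinl vle_joinr.
Qed.

End RieszTheory.

(** * Norm limits and disjointness in Banach lattices *)

Section BanachLatticeTheory.
Variables (R : realType) (E : banachLatticeType R).
Implicit Types (x y z u v : E) (A I : set E).

Lemma norm_pos_le x y : 0 <=v x -> x <=v modulus y -> `|x| <= `|y|.
Proof. by move=> x0 xy; apply: ler_norm_modulus; rewrite modulus_id. Qed.

Lemma norm_le_eps_eq0 x : (forall e : R, 0 < e -> `|x| <= e) -> x = 0.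
Proof.
move=> xe; apply/eqP; rewrite -normr_le0; apply/ler_addgt0Pr => e e0.
by rewrite add0r xe.
Qed.

Lemma closure_normP A x : closure A x <->
  forall e : R, 0 < e -> exists2 a, A a & `|x - a| <= e.
Proof.
split=> [Ax e e0|Ax B /nbhs_ballP[e/= e0 xeB]].
  have [a [Aa xa]] := Ax _ (nbhsx_ballx x e e0).
  by exists a => //; move: xa; rewrite -ball_normE/= => /ltW.
have [|a Aa xa] := Ax (e / 2); first by rewrite divr_gt0.
exists a; split=> //; apply: xeB; rewrite -ball_normE/=.
by rewrite (le_lt_trans xa)// gtr_pMr// invf_lt1 ?ltr1n.
Qed.

(** When [y] is disjoint from [z], the meet of [modulus x] and [modulus z] lies below
    [modulus (x - y)]. *)
Lemma disjoint_limit x z :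
  (forall e : R, 0 < e -> exists2 y, disjoint y z & `|x - y| <= e) ->
  disjoint x z.
Proof.
move=> xz; apply: norm_le_eps_eq0 => e /xz[y yz]; apply: le_trans.
apply: norm_pos_le; first by rewrite vle_meet !modulus_ge0.
apply: disjoint_meet_le yz _ _ (vle_meetr _ _); first exact: modulus_ge0.
apply: vle_tr (vle_meetl _ _) _.
by rewrite -{1}[x](subrKC y); exact: modulusD.
Qed.

(** [s] is the sum of the series, which converges absolutely; [s - x n] is the limit of the partial
    sums without the term [x n], all disjoint from [x n]. *)
Lemma disjoint_series (x : nat -> E) :
  (forall i j, (i < j)%N -> disjoint (x i) (x j)) ->
  (forall n, `|x n| <= 2^-1 ^+ n) ->
  exists s, forall n, disjoint (s - x n) (x n).
Proof.
move=> xx xle.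
have dx i j : i != j -> disjoint (x i) (x j).
  by rewrite neq_ltn => /orP[/xx//|/xx/disjointC].
have cx : cvgn (series x).
  apply: normed_cvg.
  apply: (@series_le_cvg _ _ (geometric 1 2^-1)) => [n|n|n|].
  - exact: normr_ge0.
  - by rewrite /= mul1r exprn_ge0// invr_ge0.
  - by rewrite /= mul1r.
  - apply: is_cvg_geometric_series.
    by rewrite ger0_norm ?invr_ge0// invf_lt1 ?ltr1n.
exists (limn (series x)) => n; apply: disjoint_limit => e e0.
have /cvgrPdist_le/(_ e e0)[N _ Ne] := cx.
pose m := (maxn N n.+1).
exists (series x m - x n); last first.
  rewrite opprB addrA subrK; apply: Ne; exact: leq_maxl.
have nm : (n < m)%N by exact: leq_maxr.
rewrite /series/= big_mkord (bigD1 (Ordinal nm))//= addrAC subrr add0r.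
elim/big_ind : _ => [|y z yn zn|i ni]; first exact: disjoint0l.
  exact: disjointDl.
by apply: dx; apply: contra ni => /eqP ni; apply/eqP/val_inj.
Qed.

(** * Ideals: generation, sums, closures, principal ideals *)

Lemma ideal0 I : is_ideal I -> I 0.
Proof. by case. Qed.

Lemma idealZ I (a : R) x : is_ideal I -> I x -> I (a *: x).
Proof. by move=> [I0 IZD _] Ix; rewrite -[_ *: _]addr0; exact: IZD. Qed.

Lemma idealD I x y : is_ideal I -> I x -> I y -> I (x + y).
Proof. by move=> [_ IZD _] Ix Iy; rewrite -[x]scale1r; exact: IZD. Qed.

Lemma idealN I x : is_ideal I -> I x -> I (- x).
Proof. by move=> iI Ix; rewrite -scaleN1r; exact: idealZ. Qed.

Lemma idealB I x y : is_ideal I -> I x -> I y -> I (x - y).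
Proof. by move=> iI Ix Iy; apply: idealD => //; exact: idealN. Qed.

Lemma ideal_le I x y : is_ideal I -> I x -> modulus y <=v modulus x -> I y.
Proof. by move=> [_ _ Ile] Ix; exact: Ile. Qed.

Lemma is_ideal_generated A : is_ideal (ideal_generated A).
Proof.
split=> [B [[]]//|a x y Ax Ay B BA|x y Ax yx B BA].
  have [[_ BZD _] _] := BA; apply: BZD; [exact: Ax|exact: Ay].
by have [[_ _ Ble] _] := BA; apply: Ble yx; exact: Ax.
Qed.

Lemma ideal_generated_sub A I : is_ideal I -> A `<=` I ->
  ideal_generated A `<=` I.
Proof. by move=> iI AI x; apply. Qed.

Lemma sub_ideal_generated A : A `<=` ideal_generated A.
Proof. by move=> x Ax B [_]; apply. Qed.

(** Carries disjointness from generators to ideals: a disjoint complement containing [u >= 0]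
    contains [principal_ideal u]. *)
Lemma is_ideal_disjoint_complement A : is_ideal (disjoint_complement A).
Proof.
split=> [x _|a x y xA yA z Az|x y xA yx z Az]; first exact: disjoint0l.
- by apply: disjointDl; [apply: disjointZl; exact: xA|exact: yA].
- by apply: disjoint_lel yx _; exact: xA.
Qed.

Lemma is_ideal_principal u : 0 <=v u -> is_ideal (principal_ideal u).
Proof.
move=> u0; split=> [|a x y [b b0 xb] [c c0 yc]|x y [b b0 xb] yx].
- by exists 0 => //; rewrite modulus0 scale0r vle_refl.
- exists (`|a| * b + c); first by rewrite addr_ge0// mulr_ge0.
  apply: vle_tr (modulusD _ _) _; rewrite scalerDl -scalerA vleD//.
  by apply: vle_tr (modulusZ_le _ _) _; exact: vleZ.
- by exists b => //; exact: vle_tr xb.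
Qed.

Lemma principal_ideal_self u : 0 <=v u -> principal_ideal u u.
Proof.
by move=> u0; exists 1; rewrite ?ler01// scale1r modulus_id// vle_refl.
Qed.

Lemma principal_ideal_sub u I : 0 <=v u -> is_ideal I -> I u ->
  principal_ideal u `<=` I.
Proof.
move=> u0 iI Iu x [a a0 xa]; apply: ideal_le (idealZ a iI Iu) _ => //.
by rewrite [X in _ <=v X]modulus_id// vle_scale.
Qed.

Definition ideal_sum I J : set E :=
  [set x | exists y z, [/\ I y, J z & x = y + z]].

Lemma is_ideal_sum I J : is_ideal I -> is_ideal J -> is_ideal (ideal_sum I J).
Proof.
move=> iI iJ; split.
- by exists 0, 0; rewrite addr0; split=> //; exact: ideal0.
- move=> a _ _ [x1 [x2 [Ix1 Jx2 ->]]] [y1 [y2 [Iy1 Jy2 ->]]].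
  exists (a *: x1 + y1), (a *: x2 + y2); split.
  + by apply: idealD => //; exact: idealZ.
  + by apply: idealD => //; exact: idealZ.
  + by rewrite scalerDr addrACA.
- move=> _ y [x1 [x2 [Ix1 Jx2 ->]]] yx.
  have [|||y1 [y2 [-> yx1 yx2 _]]] :=
      @riesz_decomposition _ _ y (modulus x1) (modulus x2).
  + exact: modulus_ge0.
  + exact: modulus_ge0.
  + exact: vle_tr (modulusD _ _).
  + by exists y1, y2; split=> //; [exact: ideal_le yx1|exact: ideal_le yx2].
Qed.

(** For solidity, take [x'] in [I] near [x]: a vector dominated by [x] splits into a part below
    [modulus x'], which is in [I], and a part below [modulus (x - x')], which is small. *)
Lemma is_ideal_closure I : is_ideal I -> is_ideal (closure I).
Proof.
move=> iI; split.
- by apply: subset_closure; exact: ideal0.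
- move=> a x y /closure_normP Ix /closure_normP Iy; apply/closure_normP => e e0.
  have c0 : 0 < `|a| + 1 by rewrite ltr_wpDl.
  have [|x' Ix' xx'] := Ix (e / 2 / (`|a| + 1)); first by rewrite !divr_gt0.
  have [|y' Iy' yy'] := Iy (e / 2); first by rewrite divr_gt0.
  exists (a *: x' + y'); first by apply: idealD => //; exact: idealZ.
  rewrite opprD addrACA -scalerBr (le_trans (ler_normD _ _))//.
  rewrite [e]splitr lerD// normrZ.
  apply: (@le_trans _ _ ((`|a| + 1) * `|x - x'|)).
    by rewrite ler_wpM2r// lerDl.
  by rewrite mulrC -ler_pdivlMr.
- move=> x y /closure_normP Ix yx; apply/closure_normP => e /Ix[x' Ix' xx'].
  have [|||y1 [y2 [-> yx1 yx2 _]]] :=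
      @riesz_decomposition _ _ y (modulus x') (modulus (x - x')).
  + exact: modulus_ge0.
  + exact: modulus_ge0.
  + by apply: vle_tr yx _; rewrite -{1}[x](subrKC x'); exact: modulusD.
  + exists y1; first exact: ideal_le yx1.
    by rewrite addrAC subrr add0r (le_trans (ler_norm_modulus _ _ yx2)).
Qed.

(** Being below [modulus x], the approximant is disjoint from whatever [x] is disjoint from. *)
Lemma closure_ideal_dominated I x (e : R) :
  is_ideal I -> closure I x -> 0 < e ->
  exists y, [/\ I y, modulus y <=v modulus x & `|x - y| <= e].
Proof.
move=> iI /closure_normP Ix /Ix[x' Ix' xx'].
have [|||y [z [xE yx' zx' yx]]] :=
    @riesz_decomposition _ _ x (modulus x') (modulus (x - x')).
- exact: modulus_ge0.
- exact: modulus_ge0.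
- by rewrite -{1}[x](subrKC x'); exact: modulusD.
- exists y; split=> //; first exact: ideal_le yx'.
  by rewrite {1}xE addrAC subrr add0r (le_trans (ler_norm_modulus _ _ zx')).
Qed.

Lemma order_dense_sub I J : I `<=` J -> order_dense I -> order_dense J.
Proof.
rewrite /order_dense => IJ Id; apply/seteqP; split=> [y yJ|_ -> x _].
  by rewrite -Id => x /IJ; exact: yJ.
exact: disjoint0l.
Qed.

(* A principal ideal without nonzero disjoint pairs is one-dimensional: the
   coordinate of [y] is [sup {a | a u <= y}]. *)
Lemma principal_ideal_atom u : 0 <v u ->
  (forall x y, principal_ideal u x -> principal_ideal u y -> disjoint x y ->
     x = 0 \/ y = 0) ->
  forall y, principal_ideal u y -> exists a : R, y = a *: u.
Proof.
move=> [u0 un0] atom y uy.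
have uI := is_ideal_principal u0; have uu := principal_ideal_self u0.
(* The positive and negative parts of [y - a *: u] are disjoint elements of the principal ideal, so
   one of them vanishes. *)
have tot (a : R) : a *: u <=v y \/ y <=v a *: u.
  pose w := y - a *: u.
  have uw : principal_ideal u w by apply: idealB => //; exact: idealZ.
  have pw : modulus (vjoin w 0) <=v modulus w.
    by rewrite modulus_id ?vle_joinr// vle_join le_modulus modulus_ge0.
  have nw : modulus (vjoin (- w) 0) <=v modulus w.
    by rewrite modulus_id ?vle_joinr// vle_join vle_joinr modulus_ge0.
  have [w0|w0] := atom _ _ (ideal_le uI uw pw) (ideal_le uI uw nw)
    (disjoint_pos_neg w).
    by right; have := vle_joinl w 0; rewrite w0 vlerBlDr add0r.
  left; have := vle_joinl (- w) 0.
  by rewrite w0 opprB vlerBlDr add0r.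
have [b b0] := uy; rewrite modulus_le -scaleNr => /andP[yb by_].
have le_scale (a c : R) : a *: u <=v c *: u -> a <= c.
  move=> auc; rewrite leNgt; apply/negP => ca; apply: un0.
  apply: vle_anti; rewrite u0/=.
  have ac0 : 0 < a - c by rewrite subr_gt0.
  rewrite -(scalerK (lt0r_neq0 ac0) u) -[0](scaler0 _ (a - c)^-1).
  by rewrite vleZ ?invr_ge0 ?(ltW ac0)// scalerBl vlerBlDr add0r.
pose A := [set a : R | a *: u <=v y].
have ubA : ubound A b by move=> a Aa; apply: le_scale; exact: vle_tr yb.
have sA : has_sup A by split; [exists (- b)|exists b].
exists (sup A); apply/eqP; rewrite -subr_eq0; apply/eqP/norm_le_eps_eq0 => e e0.
have nu : 0 < `|u| by rewrite normr_gt0; apply/eqP => /esym.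
(* With this [d], [y] lies between [(sup A - d) *: u] and [(sup A + d) *: u]. *)
pose d := e / `|u|; have d0 : 0 < d by rewrite divr_gt0.
have <- : `|d *: u| = e by rewrite normrZ gtr0_norm// divfK// gt_eqF.
apply: ler_norm_modulus; rewrite [X in _ <=v X]modulus_id ?vle_scale ?ltW//.
rewrite modulus_le !vlerBlDr vlerBrDr -scaleNr -!scalerDl; apply/andP; split.
  case: (tot (d + sup A)) => // /(sup_upper_bound sA).
  by rewrite gerDr leNgt d0.
have [a Aa sa] := sup_adherent d0 sA.
by apply: vle_tr Aa; rewrite vleZr// addrC ltW.
Qed.

End BanachLatticeTheory.

(** * Boundedness of disjointness preserving operators on ideals *)

Section DisjointnessPreserving.
Variables (R : realType) (E F : banachLatticeType R) (T : {linear E -> F}).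
Implicit Types (x y z u v : E) (A B U : set E).

Lemma norm_bounded_on_ge0 A (f : E -> F) : norm_bounded_on A f ->
  exists2 C : R, 0 <= C & forall x, A x -> `|f x| <= C * `|x|.
Proof.
move=> [C fC]; exists `|C| => // x /fC; move/le_trans; apply.
by rewrite ler_wpM2r// ler_norm.
Qed.

(** Rescaling to norm [e] turns a bound [K] on images into the operator bound [K / e], so [e] and
    [K] can be prescribed independently. *)
Lemma not_norm_bounded_on A (e K : R) : (forall a x, A x -> A (a *: x)) ->
  ~ norm_bounded_on A T -> 0 < e ->
  exists x, [/\ A x, `|x| <= e & K <= `|T x|].
Proof.
move=> AZ unb e0; apply: contrapT => noK; apply: unb.
exists (K / e) => x Ax; have [->|x0] := eqVneq x 0.
  by rewrite linear0 !normr0 mulr0.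
have nx : 0 < `|x| by rewrite normr_gt0.
have ne : 0 < e / `|x| by rewrite divr_gt0.
rewrite leNgt; apply/negP => Kx; apply: noK.
exists ((e / `|x|) *: x); split; first exact: AZ.
  by rewrite normrZ gtr0_norm// divfK// gt_eqF.
rewrite linearZ/= normrZ gtr0_norm//.
move: Kx; rewrite mulrAC ltr_pdivrMr// => /ltW Kx.
by rewrite mulrAC ler_pdivlMr// [leRHS]mulrC.
Qed.

Hypothesis dT : disjointness_preserving_on setT T.

(* Gliding hump: a disjoint sequence of small [x n] with [|T (x n)| >= n] would
   have a sum [s] with [|T (x n)| <= |T s|] for all [n]. *)
Lemma gliding_hump (BB : set (set E)) B0 : BB B0 ->
  (forall B (e K : R), BB B -> 0 < e -> exists x B',
    [/\ B x, `|x| <= e, K <= `|T x|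
      & [/\ BB B', B' `<=` B & forall y, B' y -> disjoint x y]]) -> False.
Proof.
move=> BB0 step.
(* From a step number and a current set, [f] produces the hump and the next set; the bounds
   [2^-1 ^+ n] make the norms summable. *)
have /choice[f fP] (p : nat * {B | BB B}) : exists q : E * {B | BB B},
    [/\ sval p.2 q.1, `|q.1| <= 2^-1 ^+ p.1, p.1%:R <= `|T q.1|,
        sval q.2 `<=` sval p.2 & forall y, sval q.2 y -> disjoint q.1 y].
  case: p => n [B BBB]; have [|x [B' [? ? ? [BBB' ? ?]]]] :=
    step B (2^-1 ^+ n) n%:R BBB; first by rewrite exprn_gt0// invr_gt0.
  by exists (x, exist _ B' BBB').
pose st := fix st n := if n is m.+1 then (f (m, st m)).2 else exist _ B0 BB0.
pose x n := (f (n, st n)).1.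
have stS n : sval (st n.+1) `<=` sval (st n) by have [] := fP (n, st n).
have st_le i j : (i <= j)%N -> sval (st j) `<=` sval (st i).
  elim: j => [|j IH]; first by rewrite leqn0 => /eqP ->.
  rewrite leq_eqVlt => /orP[/eqP -> //|ij].
  by apply: subset_trans (IH _) => //; exact: stS.
have xst n : sval (st n) (x n) by have [] := fP (n, st n).
have [||s sP] := @disjoint_series _ _ x.
- move=> i j ij; have [_ _ _ _] := fP (i, st i); apply.
  exact: (st_le i.+1 j) (xst j).
- by move=> n; have [] := fP (n, st n).
pose n := Num.bound `|T s|.
have : `|T s| < n%:R by exact: archi_boundP.
rewrite ltNge => /negP; apply.
have [_ _ /le_trans -> //] := fP (n, st n); rewrite -/(x n).
apply: ler_norm_modulus; rewrite -[in X in _ <=v X](subrKC (x n) s).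
rewrite linearD; apply: disjoint_le_add; apply: dT => //.
exact/disjointC/sP.
Qed.

(** Otherwise [T] is unbounded on each nonzero principal ideal inside that of [u]. None of these is
    a line, where any linear map is bounded, so by [principal_ideal_atom] each contains disjoint
    nonzero [x] and [y]. The hump is taken in the principal ideal of [modulus x], and the
    construction continues in that of [modulus y]. *)
Lemma exists_bounded_principal u : 0 <v u -> exists v,
  [/\ 0 <v v, principal_ideal u v & norm_bounded_on (principal_ideal v) T].
Proof.
move=> u0; apply: contrapT => unb.
have pI v : 0 <v v -> is_ideal (principal_ideal v).
  by move=> [v0 _]; exact: is_ideal_principal.
pose BB : set (set E) :=
  [set B | exists v, [/\ 0 <v v, principal_ideal u v & B = principal_ideal v]].
apply: (@gliding_hump BB (principal_ideal u)).
  by exists u; split=> //; apply: principal_ideal_self; case: u0.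
move=> _ e K [v [v0 uv ->]] e0.
have vu : principal_ideal v `<=` principal_ideal u.
  by apply: principal_ideal_sub => //; [case: v0|exact: pI].
have pos x : principal_ideal v x -> x <> 0 ->
    0 <v modulus x /\ principal_ideal v (modulus x).
  move=> vx x0; split; last first.
    by apply: ideal_le vx _; [exact: pI|rewrite modulus_modulus vle_refl].
  by split; [exact: modulus_ge0|move=> /esym/modulus_eq0].
have [x [y [vx vy xy x0 y0]]] : exists x y, [/\ principal_ideal v x,
    principal_ideal v y, disjoint x y, x <> 0 & y <> 0].
  apply: contrapT => noxy; apply: unb; exists v; split=> //.
  have v1 : forall x, principal_ideal v x -> exists a : R, x = a *: v.
    apply: principal_ideal_atom v0 _ => x y vx vy xy.
    apply: contrapT => /not_orP[x0 y0]; apply: noxy.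
    by exists x, y.
  exists (`|T v| / `|v|) => _ /v1[a ->]; rewrite linearZ/= !normrZ.
  rewrite mulrCA divfK// normr_eq0; apply/eqP => v00.
  by case: v0 => _; apply.
have [x1 vx1] := pos x vx x0; have [y1 vy1] := pos y vy y0.
have sub w : 0 <v w -> principal_ideal v w ->
    principal_ideal w `<=` principal_ideal v.
  by move=> [w0 _] vw; apply: principal_ideal_sub => //; exact: pI.
have [||z [xz ze Kz]] :=
    @not_norm_bounded_on (principal_ideal (modulus x)) e K _ _ e0.
- by move=> a z; apply: idealZ; exact: pI x1.
- by move=> bx; apply: unb; exists (modulus x); split=> //; exact: vu.
- exists z, (principal_ideal (modulus y)); split=> //; first exact: sub xz.
  split; [by exists (modulus y); split=> //; exact: vu|exact: sub|].
  move=> w yw.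
  have xyd : disjoint (modulus x) (modulus y).
    by apply: disjoint_le xy; rewrite modulus_modulus vle_refl.
  have xd : disjoint_complement [set modulus y] z.
    apply: (principal_ideal_sub (modulus_ge0 x)) xz.
      exact: is_ideal_disjoint_complement.
    by move=> _ ->.
  have : disjoint_complement [set z] w.
    apply: (principal_ideal_sub (modulus_ge0 y)) yw.
      exact: is_ideal_disjoint_complement.
    by move=> _ ->; apply: disjointC; exact: xd.
  by move=> /(_ z erefl)/disjointC.
Qed.

(** A nonzero [y] disjoint from the ideal would yield a [v] in the principal ideal of [modulus y]
    that can be added to [U]. By maximality [v] is already in [U], hence disjoint from itself. *)
Lemma order_dense_bounding_ideal U : maximal_bounding_family T U ->
  order_dense (ideal_generated U).
Proof.
move=> [[Ub Ud] Umax]; apply/seteqP; split=> [y yU|_ -> x _]; last first.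
  exact: disjoint0l.
apply: contrapT => y0.
have y1 : 0 <v modulus y.
  by split; [exact: modulus_ge0|move=> /esym/modulus_eq0].
have [v [v0 yv bv]] := exists_bounded_principal y1.
have vU u : U u -> disjoint v u.
  move=> Uu; suff : disjoint_complement [set u] v by apply.
  apply: principal_ideal_sub (modulus_ge0 y) _ _ _ yv.
    exact: is_ideal_disjoint_complement.
  move=> _ ->; apply: disjoint_lel (yU u _).
    by rewrite modulus_modulus vle_refl.
  exact: sub_ideal_generated.
have Uv : U v.
  have <- : U `|` [set v] = U; last by right.
  apply: Umax; last by move=> u; left.
  split=> [u [/Ub//|->//]|u w [Uu|->] [Uw|->] //].
  - exact: Ud.
  - by move=> _; apply: disjointC; exact: vU.
  - by move=> _; exact: vU.
by case: v0 => _ []; apply/esym/disjoint_self/vU.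
Qed.

(** The gliding hump runs through the sets [EU s], the parts of the ideal disjoint from a finite [s]
    within [U]. Removing finitely many pieces where [T] is bounded keeps [T] unbounded, and each [x]
    of the ideal is disjoint from some [EU t]. *)
Lemma norm_bounded_bounding_ideal U : bounding_family T U ->
  norm_bounded_on (ideal_generated U) T.
Proof.
move=> [Ub Ud]; apply: contrapT => unb.
have U0 u : U u -> 0 <=v u by move=> /Ub[[]].
have iU := is_ideal_generated U.
pose D (s : seq E) := disjoint_complement [set u | u \in s].
pose EU s := ideal_generated U `&` D s.
have iEU s : is_ideal (EU s).
  have [E0 EZD Ele] := iU.
  have [D0 DZD Dle] := is_ideal_disjoint_complement [set u | u \in s].
  split=> [//|a x y [? ?] [? ?]|x y [? ?] yx]; split.
  - exact: EZD.
  - exact: DZD.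
  - exact: Ele yx.
  - exact: Dle yx.
have unbs s : {in s, forall u, U u} -> ~ norm_bounded_on (EU s) T.
  elim: s => [_ [C TC]|u s IH us].
    by apply: unb; exists C => x Ux; apply: TC; split.
  have Uu : U u by apply: us; rewrite mem_head.
  have {}IH : ~ norm_bounded_on (EU s) T.
    by apply: IH => v sv; apply: us; rewrite inE sv orbT.
  apply: contra_not IH => /norm_bounded_on_ge0[C C0 TC].
  have [_ /norm_bounded_on_ge0[K K0 TK]] := Ub u Uu.
  exists (K + C) => x [Ux sx].
  (* Splitting off the component along [u] leaves [x2] in [EU (u :: s)]; the bounds [K] and [C] add
     because both components are below [modulus x]. *)
  have : ideal_sum (principal_ideal u) (disjoint_complement [set u]) x.
    apply: (ideal_generated_sub _ _ Ux).
      apply: is_ideal_sum; last exact: is_ideal_disjoint_complement.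
      exact: is_ideal_principal (U0 u Uu).
    move=> v Uv; have [->|uv] := pselect (v = u).
      exists u, 0; rewrite addr0; split=> //; last first.
        by move=> w _; exact: disjoint0l.
      exact: principal_ideal_self (U0 u Uu).
    exists 0, v; rewrite add0r; split=> //.
      exact: ideal0 (is_ideal_principal (U0 u Uu)).
    by move=> _ ->; exact: Ud.
  move=> [x1 [x2 [ux1 ux2 xE]]].
  have x12 : disjoint x1 x2.
    apply: disjointC; suff : disjoint_complement [set x2] x1.
      by move=> /(_ x2 erefl)/disjointC.
    apply: principal_ideal_sub (U0 u Uu) _ _ _ ux1.
      exact: is_ideal_disjoint_complement.
    by move=> _ ->; exact/disjointC/ux2.
  have x1x : modulus x1 <=v modulus x by rewrite xE disjoint_le_add.
  have x2x : modulus x2 <=v modulus x.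
    by rewrite xE addrC; exact/disjoint_le_add/disjointC.
  have [Ux2 sx2] : EU s x2 by exact: ideal_le (conj Ux sx) x2x.
  have ux2' : EU (u :: s) x2.
    split=> // v; rewrite /= inE => /orP[/eqP -> | sv]; first exact: ux2.
    exact: sx2.
  rewrite [in T _]xE linearD (le_trans (ler_normD _ _))// mulrDl lerD//.
    by rewrite (le_trans (TK _ ux1))// ler_wpM2l// ler_norm_modulus.
  by rewrite (le_trans (TC _ ux2'))// ler_wpM2l// ler_norm_modulus.
(* Each [x] lies in the double disjoint complement of a finite [t], because such vectors form an
   ideal containing [U]. *)
have supp x : ideal_generated U x ->
    exists2 t : seq E, {in t, forall u, U u} & forall y, D t y -> disjoint x y.
  apply: (ideal_generated_sub _ (I := [set x | exists2 t : seq E,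
    {in t, forall u, U u} & forall y, D t y -> disjoint x y])).
    split.
    - by exists [::] => // y _; exact: disjoint0l.
    - move=> a x1 x2 [t1 t1U xt1] [t2 t2U xt2]; exists (t1 ++ t2).
        by move=> u; rewrite mem_cat => /orP[/t1U|/t2U].
      move=> y yt; apply: disjointDl; [apply/disjointZl/xt1|apply/xt2].
        by move=> u /= ut; apply: yt; rewrite /= mem_cat ut.
      by move=> u /= ut; apply: yt; rewrite /= mem_cat ut orbT.
    - move=> x1 x2 [t tU xt] x21; exists t => // y /xt.
      exact: disjoint_lel.
  move=> u Uu; exists [:: u] => [v|y yu]; first by rewrite inE => /eqP ->.
  by apply: disjointC; apply: yu; rewrite /= inE.
pose BB : set (set E) := [set B | exists2 s, {in s, forall u, U u} & B = EU s].
apply: (@gliding_hump BB (EU [::])); first by exists [::].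
move=> _ e K [s sU ->] e0.
have [|x [sx xe Kx]] := @not_norm_bounded_on _ e K _ (unbs s sU) e0.
  by move=> a x; apply: idealZ.
have [t tU xt] := supp x sx.1.
exists x, (EU (t ++ s)); split=> //; split.
- exists (t ++ s) => // u; rewrite mem_cat => /orP[/tU|/sU] //.
- move=> y [Uy yts]; split=> // u /= us; apply: yts.
  by rewrite /= mem_cat us orbT.
- move=> y [Uy yts]; apply: xt => u /= ut; apply: yts.
  by rewrite /= mem_cat ut.
Qed.

End DisjointnessPreserving.

(** * Bounded operators on the closure of an ideal *)

Section BoundedExtension.
Variables (R : realType) (E F : banachLatticeType R).
Implicit Types (x y : E) (I A : set E) (f g : E -> F).

Lemma linear_onB A f x y : linear_on A f -> A x -> A y ->
  f (x - y) = f x - f y.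
Proof.
move=> lf Ax Ay; have := lf (-1) y x Ay Ax.
by rewrite !scaleN1r [in X in X -> _]addrC => ->; rewrite addrC.
Qed.

Lemma bounded_approx I f x (e : R) : is_ideal I -> linear_on (closure I) f ->
  norm_bounded_on (closure I) f -> closure I x -> 0 < e ->
  exists y, [/\ I y, modulus y <=v modulus x & `|f x - f y| <= e].
Proof.
move=> iI lf /norm_bounded_on_ge0[C C0 fC] Ix e0.
have icI := is_ideal_closure iI.
have C1 : 0 < C + 1 by rewrite ltr_wpDl.
have [|y [Iy yx xy]] := @closure_ideal_dominated _ _ _ _ (e / (C + 1)) iI Ix.
  by rewrite divr_gt0.
have cIy : closure I y by exact: subset_closure.
exists y; split=> //; rewrite -(linear_onB lf Ix cIy).
apply: (le_trans (fC _ (idealB icI Ix cIy))).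
apply: (@le_trans _ _ ((C + 1) * `|x - y|)).
  by rewrite ler_wpM2r// lerDl.
by rewrite mulrC -ler_pdivlMr.
Qed.

Lemma bounded_extension_unique I f g : is_ideal I ->
  linear_on (closure I) f -> norm_bounded_on (closure I) f ->
  linear_on (closure I) g -> norm_bounded_on (closure I) g ->
  (forall x, I x -> f x = g x) -> forall x, closure I x -> f x = g x.
Proof.
move=> iI lf [C fC] lg [K gK] fg x Ix; apply/eqP; rewrite -subr_eq0; apply/eqP.
pose h z := f z - g z.
have lh : linear_on (closure I) h.
  by move=> a y z Iy Iz; rewrite /h lf// lg// opprD addrACA -scalerBr.
have bh : norm_bounded_on (closure I) h.
  exists (C + K) => y Iy; rewrite (le_trans (ler_normB _ _))// mulrDl.
  by rewrite lerD ?fC ?gK.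
apply: norm_le_eps_eq0 => e /(bounded_approx iI lh bh Ix)[y [Iy _]].
by rewrite {2}/h fg// subrr subr0.
Qed.

(** Transfers disjointness from [I] to its closure: [f x] is a limit of images of dominated
    approximants, and disjointness from [w] is norm closed. *)
Lemma disjoint_bounded_approx I f x (w : F) : is_ideal I ->
  linear_on (closure I) f -> norm_bounded_on (closure I) f -> closure I x ->
  (forall y, I y -> modulus y <=v modulus x -> disjoint (f y) w) ->
  disjoint (f x) w.
Proof.
move=> iI lf bf Ix xw; apply: disjoint_limit => e e0.
have [y [Iy yx fxy]] := bounded_approx iI lf bf Ix e0.
by exists (f y) => //; exact: xw.
Qed.

(** [approx x w] puts [(x, w)] in the closure of the graph of [T] on [I]. Completeness of [F]
    provides [w]. The Lipschitz estimate [approxE] does the rest: [b = 0] gives linearity and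
    agreement with [T], while [y = 0] with [b] the norm of [x] gives the bound. *)
Lemma bounded_extension I (T : {linear E -> F}) : is_ideal I ->
  norm_bounded_on I T -> exists f, [/\ linear_on (closure I) f,
    norm_bounded_on (closure I) f & forall x, I x -> f x = T x].
Proof.
move=> iI /norm_bounded_on_ge0[C C0 TC].
have icI := is_ideal_closure iI.
have C1 : 0 < C + 1 by rewrite ltr_wpDl.
have TB (x y : E) : I x -> I y -> `|T x - T y| <= C * `|x - y|.
  by move=> Ix Iy; rewrite -linearB; apply: TC; exact: idealB.
pose approx x (w : F) := forall e : R, 0 < e ->
  exists a, [/\ I a, `|x - a| <= e & `|w - T a| <= e].
have approxE x y v w (b : R) : approx x v -> approx y w ->
    (forall e : R, 0 < e -> `|x - y| <= b + e) -> `|v - w| <= C * b.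
  move=> xv yw xy; apply/ler_addgt0Pr => e e0.
  (* The distance of [a] and [c] contributes [3 d], multiplied by [C]; the errors at [v] and [w]
     contribute [2 d]. *)
  pose d := e / (C *+ 3 + 2).
  have C3 : 0 < C *+ 3 + 2 by rewrite ltr_wpDl// mulrn_wge0.
  have d0 : 0 < d by rewrite divr_gt0.
  have [a [Ia xa va]] := xv d d0; have [c [Ic yc wc]] := yw d d0.
  have ac : `|a - c| <= b + d *+ 3.
    have -> : a - c = (x - y) - (x - a) + (y - c).
      by rewrite opprB [x - y + _]addrC !subrKA.
    rewrite (le_trans (ler_normD _ _))// (le_trans (lerD (ler_normB _ _) yc))//.
    by have := xy d d0; lra.
  have -> : v - w = (v - T a) + (T a - T c) - (w - T c).
    by rewrite opprB !subrKA.
  rewrite (le_trans (ler_normB _ _))// (le_trans (lerD (ler_normD _ _) wc))//.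
  have := TB _ _ Ia Ic; have := ler_wpM2l C0 ac.
  have : d * (C *+ 3 + 2) = e by rewrite divfK// gt_eqF.
  lra.
have ex x : exists w, closure I x -> approx x w.
  have [Ix|] := pselect (closure I x); last by exists 0.
  have FF : ProperFilter (within I (nbhs x)) by exact: within_nbhs_proper.
  have /cauchy_cvg cT : cauchy (T @ within I (nbhs x)).
    (* Points within [d] of [x] are at most [e / (C + 1)] apart, so their images are less than [e]
       apart. *)
    apply: cauchy_exP => e e0; pose d := e / (C + 1) / 2.
    have d0 : 0 < d by rewrite !divr_gt0.
    have [a Ia xa] := (closure_normP I x).1 Ix d d0.
    exists (T a); rewrite /= nbhs_filterE /fmap/=.
    apply/nbhs_ballP; exists d => //= y; rewrite -ball_normE/= => xy Iy.
    rewrite -ball_normE/= (le_lt_trans (TB _ _ Ia Iy))//.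
    have : `|a - y| <= d *+ 2.
      rewrite -(subrKA x) (le_trans (ler_normD _ _))// mulr2n lerD//.
        by rewrite distrC.
      exact: ltW.
    rewrite mulr2n -splitr => /(ler_wpM2l C0)/le_lt_trans; apply.
    by rewrite mulrCA gtr_pMr// ltr_pdivrMr// mul1r ltrDl.
  exists (lim (T @ within I (nbhs x))) => _ e e0.
  have /cvgrPdist_le/(_ e e0) near_lim := cT.
  have near_x : nbhs x [set y | `|x - y| <= e].
    apply/nbhs_ballP; exists e => //= y; rewrite -ball_normE/=; exact: ltW.
  have [a [Ia [xa /(_ Ia) wa]]] := Ix _ (filterI near_x near_lim).
  by exists a.
have [f fP] := choice ex.
have approxT x : I x -> approx x (T x).
  by move=> Ix e e0; exists x; rewrite !subrr !normr0 (ltW e0).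
exists f; split.
- move=> a x y Ix Iy; apply/eqP; rewrite -subr_eq0 -normr_le0 -(mulr0 C).
  apply: (approxE (a *: x + y) (a *: x + y) _ _ 0).
  + by apply: fP; apply: (idealD icI) => //; exact: (idealZ _ icI).
  + move=> e e0; have a1 : 0 < `|a| + 1 by rewrite ltr_wpDl.
    have d0 : 0 < e / (`|a| + 1) by rewrite divr_gt0.
    have [x' [Ix' xx' fx']] := fP x Ix _ d0.
    have [y' [Iy' yy' fy']] := fP y Iy _ d0.
    have bound (V : normedModType R) (u v : V) : `|u| <= e / (`|a| + 1) ->
        `|v| <= e / (`|a| + 1) -> `|a *: u + v| <= e.
      move=> ue ve; rewrite (le_trans (ler_normD _ _))// normrZ.
      rewrite (le_trans (lerD (ler_wpM2l (normr_ge0 a) ue) ve))//.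
      by rewrite -[X in _ + X]mul1r -mulrDl mulrC divfK// gt_eqF.
    exists (a *: x' + y'); split.
    * by apply: (idealD iI) => //; exact: (idealZ _ iI).
    * by rewrite opprD addrACA -scalerBr bound.
    * by rewrite linearP opprD addrACA -scalerBr bound.
  + by move=> e e0; rewrite subrr normr0 add0r ltW.
- exists C => x Ix; rewrite -[f x]subr0.
  apply: (approxE x 0 _ _ `|x|); first exact: fP.
    by rewrite -(linear0 T); exact: approxT (ideal0 iI).
  by move=> e e0; rewrite subr0 lerDl ltW.
- move=> x Ix; apply/eqP; rewrite -subr_eq0 -normr_le0 -(mulr0 C).
  apply: (approxE x x _ _ 0); [|exact: approxT|].
    by apply: fP; exact: subset_closure.
  by move=> e e0; rewrite subrr normr0 add0r ltW.
Qed.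

End BoundedExtension.

(** * The decomposition on the closure of [E_T] and its uniqueness *)

Theorem theorem3p4 (R : realType) (E F : banachLatticeType R)
    (T : {linear E -> F}) (U : set E) :
  disjointness_preserving_on setT T ->
  maximal_bounding_family T U ->
  exists I_T : set E,
    [/\ is_ideal I_T, order_dense I_T, closed I_T,
        ideal_generated U `<=` I_T &
        exists R_T S_T : E -> F,
          bounded_plus_singular T (ideal_generated U) I_T R_T S_T /\
          forall R' S' : E -> F,
            bounded_plus_singular T (ideal_generated U) I_T R' S' ->
            forall x, I_T x -> R' x = R_T x /\ S' x = S_T x].
Proof.
move=> dT Umax; set I := ideal_generated U.
have iI : is_ideal I := is_ideal_generated U.
have [f [lf bf fT]] :=
  bounded_extension iI (norm_bounded_bounding_ideal dT Umax.1).
exists (closure I); split.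
- exact: is_ideal_closure.
- apply: order_dense_sub (order_dense_bounding_ideal dT Umax).
  exact: subset_closure.
- exact: closed_closure.
- exact: subset_closure.
exists f, (fun x => T x - f x).
(* Only [x] is approximated here, with [y] arbitrary in [E]; [df] then approximates [y] and falls
   back on this case. *)
have dfT x y : closure I x -> disjoint x y -> disjoint (f x) (T y).
  move=> Ix xy; apply: (disjoint_bounded_approx iI lf bf Ix) => z Iz zx.
  by rewrite fT//; apply: dT => //; exact: disjoint_lel xy.
have df x y : closure I x -> closure I y -> disjoint x y ->
    disjoint (f x) (f y).
  move=> Ix Iy xy; apply: disjointC.
  apply: (disjoint_bounded_approx iI lf bf Iy) => z Iz zy.
  rewrite fT//; apply: disjointC; apply: dfT => //.
  by apply: disjoint_le xy; rewrite ?vle_refl.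
split.
  split=> [x _|//|]; first by rewrite subrKC.
  split=> [a x y Ix Iy|x y Ix Iy xy|x Ix]; last by rewrite fT// subrr.
    by rewrite lf// linearP opprD addrACA -scalerBr.
  (* Disjointness of [T x - f x] and [T y - f y] reduces to the four pairs of terms. *)
  apply: disjointBl; apply: disjointC; apply: disjointBl.
  - by apply: disjointC; exact: dT.
  - by apply: dfT => //; exact: disjointC.
  - by apply: disjointC; exact: dfT.
  - by apply: disjointC; exact: df.
move=> f' g [TE [lf' _ bf' f'T] _] x Ix.
have ff' : f' x = f x.
  apply: (bounded_extension_unique iI lf' bf' lf bf) => // y Iy.
  by rewrite f'T// fT.
by split=> //; rewrite -ff' TE// addrC addKr.
Qed.
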